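(* Let $d\ge 1$ and let $m$ be an integer with $1\le m<2d$. Then $\gamma^d_m(K^d)=1$.
   Context: $K^d=\{(x_1,\ldots,x_d)\in\mathbb{R}^d : |x_1|+\cdots+|x_d|\le 1\}$ is the $d$-dimensional crosspolytope. For a convex body $K\subset\mathbb{R}^d$ with non-empty interior and a positive integer $m$, $$\gamma^d_m(K)=\min\Big\{\lambda>0 : \exists\, u_1,\ldots,u_m\in\mathbb{R}^d \text{ such that } K\subseteq\bigcup_{i=1}^m(\lambda K+u_i)\Big\},$$ i.e. the smallest positive $\lambda$ such that $K$ can be covered by $m$ translates of $\lambda K$. *)

(* Defs.v *)
From mathcomp Require Import all_boot all_order all_algebra.
From mathcomp Require Import boolp classical_sets reals.
Set Implicit Arguments.
Unset Strict Implicit.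
Unset Printing Implicit Defensive.
Import Order.TTheory GRing.Theory Num.Theory.
Local Open Scope classical_set_scope.
Local Open Scope ring_scope.

Definition crosspolytope (R : realType) (d : nat) : set 'rV[R]_d :=
  [set x | \sum_(i < d) `|x ord0 i| <= 1].

Definition covering_ratios (R : realType) (d : nat) (K : set 'rV[R]_d)
    (m : nat) : set R :=
  [set lambda | 0 < lambda /\
    exists u : 'I_m -> 'rV[R]_d,
      K `<=` \bigcup_(i in [set: 'I_m]) [set lambda *: x + u i | x in K]].

(* The minimum of [covering_ratios K m] (an element that is also a lower
   bound, hence unique). The default value 0 is returned exactly when there is
   no minimum: 0 is never a covering ratio, so [gamma K m = r] with [r != 0]
   asserts that the minimum is attained and equals [r]. *)
Definition gamma (R : realType) (d : nat) (K : set 'rV[R]_d) (m : nat) : R :=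
  xget 0 (covering_ratios K m `&` lbound (covering_ratios K m)).

(* Main.v *)
Require Import Defs.
From mathcomp Require Import all_boot all_order all_algebra.
From mathcomp Require Import boolp classical_sets reals.
Import Order.TTheory GRing.Theory Num.Theory.
Local Open Scope classical_set_scope.
Local Open Scope ring_scope.

(** The ratio 1 is attained by a single untranslated copy of the crosspolytope,
    repeated m times.  No smaller ratio works: the 2d vertices, which are the
    vectors +e_i and -e_i, are pairwise at l1-distance exactly 2
    ([l1norm_vertexB]), whereas two points of a translate of lambda K^d are at
    l1-distance at most 2 lambda ([l1norm_crosspolytope_translate]), because K^d
    is the unit ball of the l1-norm.  With fewer than 2d translates, two
    vertices share a translate by the pigeonhole principle, so
    2 <= 2 lambda ([covering_ratio_crosspolytope_ge1]). *)

Section L1Norm.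
Context {R : realType} {d : nat}.
Implicit Types x y u : 'rV[R]_d.

Definition l1norm x : R := \sum_(i < d) `|x ord0 i|.

Lemma l1normB_le x y : l1norm (x - y) <= l1norm x + l1norm y.
Proof.
rewrite /l1norm -big_split; apply: ler_sum => i _.
by rewrite !mxE ler_normB.
Qed.

Lemma l1normZ (a : R) x : l1norm (a *: x) = `|a| * l1norm x.
Proof. by rewrite /l1norm mulr_sumr; apply: eq_bigr => i _; rewrite mxE normrM. Qed.

Lemma l1norm_delta (i : 'I_d) : l1norm (delta_mx ord0 i) = 1.
Proof.
rewrite /l1norm (bigD1 i) //= mxE !eqxx normr1 big1 ?addr0 // => k ki.
by rewrite mxE (negbTE ki) andbF normr0.
Qed.

(** Translates of lambda K have l1-diameter at most 2 lambda: the translation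
    cancels in the difference, leaving lambda times a difference of two vectors
    of norm at most 1. *)
Lemma l1norm_crosspolytope_translate {lambda : R} {u x y} : 0 <= lambda ->
  [set lambda *: z + u | z in @crosspolytope R d] x ->
  [set lambda *: z + u | z in @crosspolytope R d] y ->
  l1norm (x - y) <= lambda * 2.
Proof.
move=> lambda_ge0 [x' Kx' <-] [y' Ky' <-].
rewrite opprD addrACA subrr addr0 -scalerBr l1normZ ger0_norm // ler_wpM2l //.
by rewrite (le_trans (l1normB_le _ _)) // (lerD Kx' Ky').
Qed.

End L1Norm.

Section Vertices.
Context {R : realType} {d : nat}.
Implicit Types p q : bool * 'I_d.

Definition vertex p : 'rV[R]_d := (-1) ^+ p.1 *: delta_mx ord0 p.2.

Lemma l1norm_vertex p : l1norm (vertex p) = 1.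
Proof. by rewrite l1normZ l1norm_delta normr_sign mulr1. Qed.

(** Vertices on different axes have disjoint supports, so their norms add up;
    distinct vertices on the same axis are opposite, so their difference is
    twice one of them. *)
Lemma l1norm_vertexB {p q} : p != q -> l1norm (vertex p - vertex q) = 2.
Proof.
case: p q => [b i] [c j]; rewrite xpair_eqE.
have [<-{j}|neq_ij _] := eqVneq i j.
  rewrite andbT => neq_bc.
  have -> : vertex (c, i) = - vertex (b, i).
    rewrite /vertex -scaleNr /=; congr (_ *: _).
    by case: b c neq_bc => [] [] //= _; rewrite ?opprK.
  rewrite opprK -mulr2n -scaler_nat l1normZ l1norm_vertex mulr1.
  by rewrite ger0_norm.
transitivity (l1norm (vertex (b, i)) + l1norm (vertex (c, j))); last first.
  by rewrite !l1norm_vertex.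
rewrite /l1norm -big_split; apply: eq_bigr => k _; rewrite !mxE /=.
have [->|_] := eqVneq k i.
  by rewrite (negbTE neq_ij) mulr0 subr0 normr0 addr0.
by rewrite mulr0 sub0r normrN normr0 add0r.
Qed.

End Vertices.

Lemma covering_ratio_crosspolytope_ge1 {R : realType} {d m : nat} {lambda : R} :
  (m < 2 * d)%N -> covering_ratios (@crosspolytope R d) m lambda -> 1 <= lambda.
Proof.
move=> lt_m_2d [lambda_gt0 [u cover]].
have /choice[f fP] (p : bool * 'I_d) : exists k : 'I_m,
    [set lambda *: x + u k | x in @crosspolytope R d] (vertex p).
  have Kp : @crosspolytope R d (vertex p).
    by rewrite /crosspolytope /= -/(l1norm _) l1norm_vertex.
  by have [k _ Hk] := cover _ Kp; exists k.
have /injectivePn[p [q neq_pq eq_f]] : ~~ injectiveb f.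
  apply/negP => /injectiveP /leq_card.
  by rewrite card_prod card_bool !card_ord leqNgt lt_m_2d.
have fq := fP q; rewrite -eq_f in fq.
have := l1norm_crosspolytope_translate (ltW lambda_gt0) (fP p) fq.
by rewrite l1norm_vertexB // ler_pMl.
Qed.

Lemma covering_ratios1 {R : realType} {d m : nat} (K : set 'rV[R]_d) :
  (0 < m)%N -> covering_ratios K m 1.
Proof.
move=> m_gt0; split=> //; exists (fun=> 0) => x Kx.
by exists (Ordinal m_gt0) => //; exists x => //; rewrite scale1r addr0.
Qed.

Theorem theorem1 (R : realType) (d m : nat)
    (hd : (1 <= d)%N) (hm1 : (1 <= m)%N) (hm2 : (m < 2 * d)%N) :
  gamma (@crosspolytope R d) m = 1.
Proof.
have ratio1 := covering_ratios1 (@crosspolytope R d) hm1.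
apply: xget_unique => [|lambda [ratio_lambda lambda_lb]].
  by split=> // lambda; exact: covering_ratio_crosspolytope_ge1.
apply/eqP; rewrite eq_le lambda_lb //=.
exact: covering_ratio_crosspolytope_ge1 hm2 ratio_lambda.
Qed.
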